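(* Let $\mathcal Z$ be a given information zone for problem (CM). Let $\{z^k\}_{k\in\mathbb N}=\{(x^k,u^k,y^k)\}_{k\in\mathbb N}$ be a Lagrangian sequence and assume that the multiplier sequence $\{y^k\}_{k\in\mathbb N}$ is bounded. Then there exists an index $k_{\rm info}\in\mathbb N$ such that $x^k\in\mathcal Z$ for all $k\ge k_{\rm info}$.
   Context: Problem (CM): minimize $f(x)=f_0(x)+h(F(x))$ over $x\in\mathbb R^n$, where $f_0:\mathbb R^n\to\mathbb R$ and $F:\mathbb R^n\to\mathbb R^m$ ($m\le n$) are continuously differentiable, and $h:\mathbb R^m\to(-\infty,+\infty]$ is proper and lower semicontinuous with $\operatorname{dom}h=\{u:h(u)<\infty\}$ nonempty and closed. $\nabla F(x)\in\mathbb R^{m\times n}$ is the Jacobian; $\|\cdot\|$ is the Euclidean norm (operator norm for matrices). $\partial$ and $\partial^\infty$ denote the limiting and the horizon subdifferential (Rockafellar–Wets). Augmented Lagrangian: for $\rho>0$, $\mathcal L^\sharp_\rho(x,u,y)=f_0(x)+h(u)+\langle y,F(x)-u\rangle+\frac\rho2\|F(x)-u\|^2$ on $\mathbb R^n\times\mathbb R^m\times\mathbb R^m$. Lyapunov function: for $\beta>0$, $\mathcal E_\beta(x,u,y,w)=\mathcal L^\sharp_\rho(x,u,y)+\beta\|x-w\|^2$, $w\in\mathbb R^n$; $\mathcal E_{\beta_k}$ is built with $\rho=\rho_k$. Standing assumptions. (Well-posedness) $\inf_{x,u}\mathcal L^\sharp_\rho(x,u,y)>-\infty$ for every fixed $y\in\mathbb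 R^m$ (and $\rho>0$). (Assumption 1) For every $x$ with $F(x)\in\operatorname{dom}h$: $\nabla F(x)^Ty=0$ and $y\in\partial^\infty h(F(x))$ imply $y=0$. (Assumption 2) A set $\mathcal Z\subset\mathbb R^n$ (an information zone) is given, i.e. for some $\bar d\in(0,+\infty]$, $\mathcal Z\supset\{x:\operatorname{dist}(F(x),\operatorname{dom}h)\le\bar d\}\supset\{x:F(x)\in\operatorname{dom}h\}$, and: (i) there is $\gamma>0$ with $\|\nabla F(x)^Tv\|\ge\gamma\|v\|$ for all $x\in\mathcal Z$, $v\in\mathbb R^m$; (ii) $\nabla F$ is $L(F)$-Lipschitz on $\mathcal Z$; (iii) $\nabla f_0$ is $L(f_0)$-Lipschitz on $\mathcal Z$. Algorithm ALBUM. A Lagrangian algorithmic map $\mathcal A_\rho$ is a (set-valued) map $(x,u,y)\mapsto\mathcal A_\rho(x,u,y)\subset\mathbb R^n\times\mathbb R^m$ for which there are constants $a,b>0$ (the same for all penalty parameters $\rho$ used) such that every $(x^+,u^+)\in\mathcal A_\rho(x,u,y)$ satisfies $\frac a2\|x^+-x\|^2+\mathcal L^\sharp_\rho(x^+,u^+,y)\le\mathcal L^\sharp_\rho(x,u,y)$ and $\|\nabla_x\mathcal L^\sharp_\rho(x^+,u^+,y)\|\le b\|x^+-x\|$. Fix $\delta,\rho_0>0$, $\tau\in(0,\frac a2)$, any $(x^0,u^0,y^0)$ and any $x^{-1}\in\mathbb R^n$. For $k=0,1,\dots$: (1) $(x^{k+1},u^{k+1})\in\mathcal A_{\rho_k}(x^k,u^k,y^k)$;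 (2) $y^{k+1}=y^k+\rho_k(F(x^{k+1})-u^{k+1})$; (3) set $\beta_k=\frac{2b^2}{\rho_k\gamma^2}$; if $x^{k+1}\notin\mathcal Z$ or $\tau\|x^{k+1}-x^k\|^2>\mathcal E_{\beta_k}(x^k,u^k,y^k,x^{k-1})-\mathcal E_{\beta_k}(x^{k+1},u^{k+1},y^{k+1},x^k)$, set $\rho_{k+1}=\rho_k+\delta$; otherwise $\rho_{k+1}=\rho_k$. Lagrangian sequence: a sequence $z^k=(x^k,u^k,y^k)$ generated by ALBUM such that (C1) $\frac a2\|x^{k+1}-x^k\|^2+\mathcal L^\sharp_{\rho_k}(x^{k+1},u^{k+1},y^k)\le\mathcal L^\sharp_{\rho_k}(x^k,u^k,y^k)$ for all $k\ge0$; (C2) $\|\nabla_x\mathcal L^\sharp_{\rho_k}(x^{k+1},u^{k+1},y^k)\|\le b\|x^{k+1}-x^k\|$ for all $k\ge0$; (C3) there is $c>0$ such that for all $k\ge0$ some $v^{k+1}\in\partial_u\mathcal L^\sharp_{\rho_k}(x^{k+1},u^{k+1},y^k)$ satisfies $\|v^{k+1}\|\le c\|x^{k+1}-x^k\|$; (C4) whenever a subsequence $\{u^k\}_{k\in\mathcal K}$ converges to some $\bar u$, $\limsup_{k\in\mathcal K}h(u^k)\le h(\bar u)$. *)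

(* Defs.v *)
From HB Require Import structures.
From mathcomp Require Import all_boot all_order all_algebra.
From mathcomp Require Import all_classical all_reals all_analysis.
Import Order.TTheory GRing.Theory Num.Theory.
Import numFieldNormedType.Exports.

Set Implicit Arguments.
Unset Strict Implicit.
Unset Printing Implicit Defensive.

Local Open Scope classical_set_scope.
Local Open Scope ring_scope.

(* R^n is 'rV[R]_n.  The library norm `|v| on matrices is the sup norm, hence
   the explicit Euclidean structure below (the topologies coincide). *)

Definition dot (R : realType) (n : nat) (v w : 'rV[R]_n) : R :=
  \sum_(i < n) v ord0 i * w ord0 i.

Definition enorm (R : realType) (n : nat) (v : 'rV[R]_n) : R :=
  Num.sqrt (dot v v).

Definition opnorm (R : realType) (n m : nat) (A : 'M[R]_(n, m)) : R :=
  sup [set enorm (v *m A) | v in [set v : 'rV[R]_n | enorm v <= 1]].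

Definition grad (R : realType) (n : nat) (g : 'rV[R]_n -> R) (x : 'rV[R]_n) :
    'rV[R]_n :=
  \row_(j < n) 'D_(delta_mx ord0 j) g x.

(* The library Jacobian 'J F x : 'M_(n, m) acts on row vectors from the right,
   v |-> v *m 'J F x, so it is the transpose of the usual m x n Jacobian. The
   row form of (nabla F(x))^T v, v in R^m, is therefore v *m ('J F x)^T. *)
Definition jacT_apply (R : realType) (n m : nat)
    (F : 'rV[R]_n -> 'rV[R]_m) (x : 'rV[R]_n) (v : 'rV[R]_m) : 'rV[R]_n :=
  v *m ('J F x)^T.

Definition edom (R : realType) (m : nat) (h : 'rV[R]_m -> \bar R) :
    set 'rV[R]_m :=
  [set u | (h u < +oo)%E].

Definition edist (R : realType) (m : nat) (u : 'rV[R]_m) (D : set 'rV[R]_m) :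
    \bar R :=
  ereal_inf [set (enorm (u - w))%:E | w in D].

(* The near-condition is f w >= f u + <v, w - u> + o(||w - u||). *)
Definition regular_subdiff (R : realType) (m : nat) (f : 'rV[R]_m -> \bar R)
    (u : 'rV[R]_m) : set 'rV[R]_m :=
  [set v | f u \is a fin_num /\
     forall eps : R, 0 < eps ->
       \forall w \near u,
         (f u + (dot v (w - u) - eps * enorm (w - u))%:E <= f w)%E].

Definition limiting_subdiff (R : realType) (m : nat) (f : 'rV[R]_m -> \bar R)
    (u : 'rV[R]_m) : set 'rV[R]_m :=
  [set v | f u \is a fin_num /\
     exists us vs : nat -> 'rV[R]_m,
       [/\ us k @[k --> \oo] --> u,
           f (us k) @[k --> \oo] --> f u,
           forall k, regular_subdiff f (us k) (vs k)
         & vs k @[k --> \oo] --> v]].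

Definition horizon_subdiff (R : realType) (m : nat) (f : 'rV[R]_m -> \bar R)
    (u : 'rV[R]_m) : set 'rV[R]_m :=
  [set v | f u \is a fin_num /\
     exists (us vs : nat -> 'rV[R]_m) (lam : nat -> R),
       [/\ us k @[k --> \oo] --> u,
           f (us k) @[k --> \oo] --> f u,
           forall k, regular_subdiff f (us k) (vs k),
           (forall k, 0 < lam k) /\ lam k @[k --> \oo] --> 0
         & lam k *: vs k @[k --> \oo] --> v]].

Record CM_problem (R : realType) (n m : nat) (f0 : 'rV[R]_n -> R)
    (F : 'rV[R]_n -> 'rV[R]_m) (h : 'rV[R]_m -> \bar R) : Prop := {
  CM_dim : (m <= n)%N;
  CM_f0_diff : forall x, differentiable f0 x;
  CM_f0_cont : continuous (grad f0);
  CM_F_diff : forall x, differentiable F x;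
  CM_F_cont : continuous (fun x => 'J F x);
  CM_h_gtNy : forall u, (-oo < h u)%E;
  CM_h_lsc : lower_semicontinuous h;
  CM_dom_nonempty : edom h !=set0;
  CM_dom_closed : closed (edom h)
}.

Definition auglag_smooth (R : realType) (n m : nat) (f0 : 'rV[R]_n -> R)
    (F : 'rV[R]_n -> 'rV[R]_m) (rho : R)
    (x : 'rV[R]_n) (u y : 'rV[R]_m) : R :=
  f0 x + dot y (F x - u) + rho / 2 * enorm (F x - u) ^+ 2.

Definition auglag (R : realType) (n m : nat) (f0 : 'rV[R]_n -> R)
    (F : 'rV[R]_n -> 'rV[R]_m) (h : 'rV[R]_m -> \bar R) (rho : R)
    (x : 'rV[R]_n) (u y : 'rV[R]_m) : \bar R :=
  ((auglag_smooth f0 F rho x u y)%:E + h u)%E.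

(* As h u does not depend on x, the x-gradient of auglag is that of its
   real-valued part; this also gives it its usual meaning when h u = +oo. *)
Definition grad_x_auglag (R : realType) (n m : nat) (f0 : 'rV[R]_n -> R)
    (F : 'rV[R]_n -> 'rV[R]_m) (rho : R)
    (x : 'rV[R]_n) (u y : 'rV[R]_m) : 'rV[R]_n :=
  grad (fun x' => auglag_smooth f0 F rho x' u y) x.

Definition lyapunov (R : realType) (n m : nat) (f0 : 'rV[R]_n -> R)
    (F : 'rV[R]_n -> 'rV[R]_m) (h : 'rV[R]_m -> \bar R) (rho beta : R)
    (x : 'rV[R]_n) (u y : 'rV[R]_m) (w : 'rV[R]_n) : \bar R :=
  (auglag f0 F h rho x u y + (beta * enorm (x - w) ^+ 2)%:E)%E.

Definition well_posed (R : realType) (n m : nat) (f0 : 'rV[R]_n -> R)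
    (F : 'rV[R]_n -> 'rV[R]_m) (h : 'rV[R]_m -> \bar R) : Prop :=
  forall (rho : R) (y : 'rV[R]_m), 0 < rho ->
    (-oo < ereal_inf (range (fun p : 'rV[R]_n * 'rV[R]_m =>
                               auglag f0 F h rho p.1 p.2 y)))%E.

Definition constraint_qualification (R : realType) (n m : nat)
    (F : 'rV[R]_n -> 'rV[R]_m) (h : 'rV[R]_m -> \bar R) : Prop :=
  forall x, edom h (F x) ->
    forall y, jacT_apply F x y = 0 -> horizon_subdiff h (F x) y -> y = 0.

Definition information_zone (R : realType) (n m : nat)
    (F : 'rV[R]_n -> 'rV[R]_m) (h : 'rV[R]_m -> \bar R)
    (Z : set 'rV[R]_n) : Prop :=
  exists dbar : \bar R, [/\ (0 < dbar)%E,
    [set x | (edist (F x) (edom h) <= dbar)%E] `<=` Z &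
    [set x | edom h (F x)] `<=` [set x | (edist (F x) (edom h) <= dbar)%E]].

Record zone_regularity (R : realType) (n m : nat) (f0 : 'rV[R]_n -> R)
    (F : 'rV[R]_n -> 'rV[R]_m) (Z : set 'rV[R]_n) (gamma LF Lf0 : R) :
    Prop := {
  zone_gamma_gt0 : 0 < gamma;
  zone_uniform : forall x, Z x -> forall v : 'rV[R]_m,
    gamma * enorm v <= enorm (jacT_apply F x v);
  zone_LF_ge0 : 0 <= LF;
  zone_lip_F : forall x x', Z x -> Z x' ->
    opnorm ('J F x - 'J F x') <= LF * enorm (x - x');
  zone_Lf0_ge0 : 0 <= Lf0;
  zone_lip_f0 : forall x x', Z x -> Z x' ->
    enorm (grad f0 x - grad f0 x') <= Lf0 * enorm (x - x')
}.

Definition lagrangian_map (R : realType) (n m : nat) (f0 : 'rV[R]_n -> R)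
    (F : 'rV[R]_n -> 'rV[R]_m) (h : 'rV[R]_m -> \bar R) (a b rho : R)
    (A : 'rV[R]_n -> 'rV[R]_m -> 'rV[R]_m -> set ('rV[R]_n * 'rV[R]_m)) :
    Prop :=
  forall x u y xp up, A x u y (xp, up) ->
    ((a / 2 * enorm (xp - x) ^+ 2)%:E + auglag f0 F h rho xp up y
       <= auglag f0 F h rho x u y)%E /\
    enorm (grad_x_auglag f0 F rho xp up y) <= b * enorm (xp - x).

Definition prev (T : Type) (xm1 : T) (x : nat -> T) (k : nat) : T :=
  if k is k'.+1 then x k' else xm1.

Definition penalty_increase (R : realType) (n m : nat) (f0 : 'rV[R]_n -> R)
    (F : 'rV[R]_n -> 'rV[R]_m) (h : 'rV[R]_m -> \bar R)
    (Z : set 'rV[R]_n) (gamma b tau : R) (xm1 : 'rV[R]_n)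
    (x : nat -> 'rV[R]_n) (u y : nat -> 'rV[R]_m) (rho : nat -> R) (k : nat) :
    Prop :=
  let beta := 2 * b ^+ 2 / (rho k * gamma ^+ 2) in
  ~ Z (x k.+1) \/
  (lyapunov f0 F h (rho k) beta (x k) (u k) (y k) (prev xm1 x k)
   - lyapunov f0 F h (rho k) beta (x k.+1) (u k.+1) (y k.+1) (x k)
   < (tau * enorm (x k.+1 - x k) ^+ 2)%:E)%E.

(* The starting data (x^0, u^0, y^0) and rho_0 are the values at index 0. *)
Record ALBUM (R : realType) (n m : nat) (f0 : 'rV[R]_n -> R)
    (F : 'rV[R]_n -> 'rV[R]_m) (h : 'rV[R]_m -> \bar R)
    (Z : set 'rV[R]_n) (gamma a b tau delta : R)
    (A : R -> 'rV[R]_n -> 'rV[R]_m -> 'rV[R]_m -> set ('rV[R]_n * 'rV[R]_m))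
    (xm1 : 'rV[R]_n) (x : nat -> 'rV[R]_n) (u y : nat -> 'rV[R]_m)
    (rho : nat -> R) : Prop := {
  ALBUM_a_gt0 : 0 < a;
  ALBUM_b_gt0 : 0 < b;
  ALBUM_delta_gt0 : 0 < delta;
  ALBUM_rho0_gt0 : 0 < rho 0%N;
  ALBUM_tau : 0 < tau < a / 2;
  ALBUM_map : forall k, lagrangian_map f0 F h a b (rho k) (A (rho k));
  ALBUM_primal : forall k, A (rho k) (x k) (u k) (y k) (x k.+1, u k.+1);
  ALBUM_dual : forall k, y k.+1 = y k + rho k *: (F (x k.+1) - u k.+1);
  ALBUM_penalty : forall k, rho k.+1 =
    if `[< penalty_increase f0 F h Z gamma b tau xm1 x u y rho k >]
    then rho k + delta else rho k
}.

Record lagrangian_sequence (R : realType) (n m : nat) (f0 : 'rV[R]_n -> R)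
    (F : 'rV[R]_n -> 'rV[R]_m) (h : 'rV[R]_m -> \bar R)
    (Z : set 'rV[R]_n) (gamma a b tau delta : R)
    (A : R -> 'rV[R]_n -> 'rV[R]_m -> 'rV[R]_m -> set ('rV[R]_n * 'rV[R]_m))
    (xm1 : 'rV[R]_n) (x : nat -> 'rV[R]_n) (u y : nat -> 'rV[R]_m)
    (rho : nat -> R) : Prop := {
  lagseq_ALBUM : ALBUM f0 F h Z gamma a b tau delta A xm1 x u y rho;
  lagseq_C1 : forall k,
    ((a / 2 * enorm (x k.+1 - x k) ^+ 2)%:E
       + auglag f0 F h (rho k) (x k.+1) (u k.+1) (y k)
     <= auglag f0 F h (rho k) (x k) (u k) (y k))%E;
  lagseq_C2 : forall k,
    enorm (grad_x_auglag f0 F (rho k) (x k.+1) (u k.+1) (y k))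
      <= b * enorm (x k.+1 - x k);
  lagseq_C3 : exists2 c : R, 0 < c & forall k, exists2 v : 'rV[R]_m,
    limiting_subdiff (fun w => auglag f0 F h (rho k) (x k.+1) w (y k))
      (u k.+1) v
    & enorm v <= c * enorm (x k.+1 - x k);
  lagseq_C4 : forall (phi : nat -> nat) (ubar : 'rV[R]_m),
    {homo phi : i j / (i < j)%N} ->
    u (phi j) @[j --> \oo] --> ubar ->
    (limn_esup (fun j => h (u (phi j))) <= h ubar)%E
}.

(* Main.v *)
(* If x^k left Z infinitely often, the penalty would be raised by delta
   infinitely often, so rho_k would be unbounded.  But the dual update gives
   |F(x^{k+1}) - u^{k+1}| = |y^{k+1} - y^k| / rho_k <= 2 M / rho_k, where
   u^{k+1} lies in dom h because of (C3); once rho_k is large, F(x^{k+1}) is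
   therefore within dbar of dom h, which forces x^{k+1} into Z. *)

Require Import Defs.
From HB Require Import structures.
From mathcomp Require Import all_boot all_order all_algebra.
From mathcomp Require Import all_classical all_reals all_analysis.
From mathcomp Require Import ring lra.
Import Order.TTheory GRing.Theory Num.Theory.
Import numFieldNormedType.Exports.

Set Implicit Arguments.
Unset Strict Implicit.

Local Open Scope classical_set_scope.
Local Open Scope ring_scope.

(** Monotonicity preserves every gain between two jumps, so [j] jumps lift [r] to at least
    [r 0 + j * delta]; the Archimedean property then gives a [j] that passes [C]. *)
Lemma frequent_increment_unbounded (R : realType) (r : nat -> R) (delta : R) :
  0 < delta -> {homo r : i j / (i <= j)%N >-> i <= j} ->
  (forall N, exists2 k, (N <= k)%N & r k + delta <= r k.+1) ->
  forall C, exists N, C <= r N.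
Proof.
move=> delta_gt0 r_homo r_incr C.
have r_ge j : exists N, r 0%N + delta *+ j <= r N.
  elim: j => [|j [N rN]]; first by exists 0%N; rewrite mulr0n addr0.
  have [k Nk rk] := r_incr N; exists k.+1.
  apply: le_trans rk; rewrite mulrSr addrA lerD2r.
  exact: le_trans rN (r_homo _ _ Nk).
have [N rN] := r_ge (Num.truncn `|(C - r 0%N) / delta|).+1.
exists N; apply: le_trans rN; rewrite -lerBlDl -mulr_natr mulrC -ler_pdivrMr//.
by apply: le_trans (ler_norm _) _; apply/ltW/truncnS_gt.
Qed.

Lemma enorm_ge0 (R : realType) (n : nat) (v : 'rV[R]_n) : 0 <= enorm v.
Proof. exact: sqrtr_ge0. Qed.

Lemma dot_self_ge0 (R : realType) (n : nat) (v : 'rV[R]_n) : 0 <= dot v v.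
Proof. by apply: sumr_ge0 => i _; rewrite -expr2 sqr_ge0. Qed.

Lemma enormZ (R : realType) (n : nat) (c : R) (v : 'rV[R]_n) :
  enorm (c *: v) = `|c| * enorm v.
Proof.
rewrite /enorm -sqrtr_sqr -sqrtrM ?sqr_ge0//; congr Num.sqrt.
rewrite /dot mulr_sumr; apply: eq_bigr => i _; rewrite !mxE; ring.
Qed.

(* Uses (s - t)^2 <= 2 s^2 + 2 t^2, which avoids Cauchy-Schwarz. *)
Lemma enormB_le2 (R : realType) (n : nat) (v w : 'rV[R]_n) (M : R) :
  enorm v <= M -> enorm w <= M -> enorm (v - w) <= 2 * M.
Proof.
move=> vM wM.
have M_ge0 : 0 <= M by exact: le_trans (enorm_ge0 v) vM.
have dot_le z : enorm z <= M -> dot z z <= M ^+ 2.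
  by rewrite -(sqr_sqrtr (dot_self_ge0 z)) ler_pXn2r// nnegrE ?sqrtr_ge0.
rewrite -[leRHS]ger0_norm ?mulr_ge0// -sqrtr_sqr ler_wsqrtr//.
have -> : (2 * M) ^+ 2 = 2 * M ^+ 2 + 2 * M ^+ 2 by ring.
apply: (@le_trans _ _ (2 * dot v v + 2 * dot w w)); last first.
  by rewrite lerD// ler_wpM2l// dot_le.
rewrite /dot !mulr_sumr -big_split/=; apply: ler_sum => i _; rewrite !mxE.
have := sqr_ge0 (v ord0 i + w ord0 i); nra.
Qed.

(** The zone radius may be [+oo], while the penalty threshold has to divide by a real radius. *)
Lemma ereal_gt0_fin_lb (R : realType) (d : \bar R) :
  (0 < d)%E -> exists2 e : R, 0 < e & (e%:E <= d)%E.
Proof.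
case: d => [r| |]; rewrite ?lte_fin//; first by exists r.
by move=> _; exists 1 => //; rewrite leey.
Qed.

Theorem lemma4p1 (R : realType) (n m : nat)
    (f0 : 'rV[R]_n -> R) (F : 'rV[R]_n -> 'rV[R]_m) (h : 'rV[R]_m -> \bar R)
    (Hprob : CM_problem f0 F h)
    (Hwp : well_posed f0 F h)
    (Hcq : constraint_qualification F h)
    (Z : set 'rV[R]_n) (gamma LF Lf0 : R)
    (HZ : information_zone F h Z)
    (Hreg : zone_regularity f0 F Z gamma LF Lf0)
    (a b tau delta : R)
    (A : R -> 'rV[R]_n -> 'rV[R]_m -> 'rV[R]_m -> set ('rV[R]_n * 'rV[R]_m))
    (xm1 : 'rV[R]_n) (x : nat -> 'rV[R]_n) (u y : nat -> 'rV[R]_m)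
    (rho : nat -> R)
    (Hseq : lagrangian_sequence f0 F h Z gamma a b tau delta A xm1 x u y rho)
    (Hbnd : exists M : R, forall k, enorm (y k) <= M) :
  exists kinfo : nat, forall k : nat, (kinfo <= k)%N -> Z (x k).
Proof.
have [[_ _ delta_gt0 rho0_gt0 _ _ _ dualE rhoE] _ _ [c _ Hsub] _] := Hseq.
have [M yM] := Hbnd.
have [dbar [dbar_gt0 subZ _]] := HZ.
have [d d_gt0 d_le] := ereal_gt0_fin_lb dbar_gt0.
have rho_homo : {homo rho : i j / (i <= j)%N >-> i <= j}.
  apply: homo_leq => // [? ? ?|k]; first exact: le_trans.
  by rewrite rhoE; case: ifP => // _; rewrite lerDl ltW.
have rho_gt0 k : 0 < rho k by apply: lt_le_trans rho0_gt0 (rho_homo _ _ _).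
(* A limiting subgradient exists only where the function is finite, and finiteness of the augmented
   Lagrangian forces that of [h]. *)
have dom_u k : edom h (u k.+1).
  have [v [+ _] _] := Hsub k.
  by rewrite /auglag fin_numD => /andP[_]; rewrite fin_numElt => /andP[].
(* The threshold is the value of [rho k] at which the residual bound [2 * M / rho k] drops to
   [d]. *)
have large_Z k : 2 * M / d <= rho k -> Z (x k.+1).
  move=> rho_large; apply: subZ => /=; apply: le_trans d_le.
  apply: (@le_trans _ _ (enorm (F (x k.+1) - u k.+1))%:E).
    by apply: ereal_inf_lbound; exists (u k.+1).
  have -> : F (x k.+1) - u k.+1 = (rho k)^-1 *: (y k.+1 - y k).
    by rewrite dualE addrAC subrr add0r scalerK ?gt_eqF.
  rewrite lee_fin enormZ gtr0_norm ?invr_gt0// mulrC ler_pdivrMr// mulrC.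
  apply: le_trans (enormB_le2 (yM _) (yM _)) _.
  by rewrite -ler_pdivrMr.
apply: contrapT => Hnot.
have rho_incr N : exists2 k, (N <= k)%N & rho k + delta <= rho k.+1.
  (* Without a raise from [N] on, the first test of [penalty_increase] never fires there. Iteration
     [k] tests [x k.+1], hence the bound [N.+1]. *)
  apply: contrapT => Hno; apply: Hnot; exists N.+1 => -[//|k] Nk.
  apply: contrapT => Zk; apply: Hno; exists k => //.
  by rewrite [leRHS]rhoE; case: asboolP => // -[]; left.
have [N rhoN] :=
  frequent_increment_unbounded delta_gt0 rho_homo rho_incr (2 * M / d).
(* Once reached, the threshold stays exceeded because [rho] never decreases, so no later iterate
   leaves [Z]. *)
apply: Hnot; exists N.+1 => -[//|k] Nk.
by apply: large_Z; exact: le_trans rhoN (rho_homo N k Nk).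
Qed.
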